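(* Let $f_i\in\Gamma_0(\mathbb{R}^{n_i})$, let $A_i$ be a real $m\times n_i$ matrix and $\alpha_i>0$ for $i=1,\dots,s$, and let $\beta>0$. Assume that the problem $\min\{\sum_{i=1}^s f_i(x_i):\sum_{i=1}^s A_ix_i=b,\ x_i\in\mathbb{R}^{n_i}\}$ has at least one solution and that $b\in A\big(\mathrm{ri}(\mathrm{dom}(\sum_{i=1}^s f_i))\big)$. Let $\mathcal{M}=\{M_0,M_1,M_2\}$ be a set of real $(n+m)\times(n+m)$ matrices such that $T_{\mathcal{M}}$ is well-defined. For any given $v^0,v^1\in\mathbb{R}^{n+m}$, let $\{v^k\}_{k\in\mathbb{N}}$ be generated by $$v^{k+1}=\mathcal{T}\big((E-R^{-1}M_0)v^{k+1}+R^{-1}M_1v^k+R^{-1}M_2v^{k-1}\big),\qquad k\ge1.$$ If $\mathcal{M}$ satisfies Condition-M, then, as $k\to\infty$: (i) $\displaystyle \frac1k\sum_{i=1}^k\|v^{i+1}-v^i\|_2^2=O\Big(\frac1k\Big)$; (ii) $\displaystyle \min_{1\le i\le k}\|v^{i+1}-v^i\|_2^2=o\Big(\frac1k\Big)$.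
   Context: $s,m,n_1,\dots,n_s$ are positive integers, $n=\sum_i n_i$, $\mathbb{R}^n=\mathbb{R}^{n_1}\times\cdots\times\mathbb{R}^{n_s}$. $\Gamma_0(\mathbb{R}^d)$: proper lower semicontinuous convex functions $\mathbb{R}^d\to\mathbb{R}\cup\{+\infty\}$. $A=[A_1\ \cdots\ A_s]$, $b\in\mathbb{R}^m$, $C=\{b\}$, $\iota_C$ the indicator function of $C$ ($0$ on $C$, $+\infty$ elsewhere), $\varphi^*(y)=\sup_x\{\langle x,y\rangle-\varphi(x)\}$ the conjugate, $\mathrm{prox}_\varphi(x)=\mathrm{argmin}_u\{\frac12\|u-x\|_2^2+\varphi(u)\}$. $\sum_i f_i$ denotes $x\mapsto\sum_i f_i(x_i)$ on $\mathbb{R}^n$; $\mathrm{ri}$ is relative interior. For $v=(x_1,\dots,x_s,y)\in\mathbb{R}^{n+m}$: $\mathcal{T}(v)=(\mathrm{prox}_{\frac{\alpha_1}{\beta}f_1}(x_1),\dots,\mathrm{prox}_{\frac{\alpha_s}{\beta}f_s}(x_s),\mathrm{prox}_{\beta\iota_C^*}(y))$. $P=\mathrm{diag}(\frac{\beta}{\alpha_1}I_{n_1},\dots,\frac{\beta}{\alpha_s}I_{n_s})$, $R=\mathrm{diag}(P,\frac1\beta I_m)$, $E=\begin{bmatrix}I&-P^{-1}A^\top\\ \beta A&I\end{bmatrix}$. $T_{\mathcal{M}}$ is the map sending $(u_1,u_2)\in\mathbb{R}^{n+m}\times\mathbb{R}^{n+m}$ to the $w\in\mathbb{R}^{n+m}$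 satisfying $w=\mathcal{T}((E-R^{-1}M_0)w+R^{-1}M_1u_1+R^{-1}M_2u_2)$; it is called well-defined if for every $(u_1,u_2)$ there is exactly one such $w$. Condition-M for a set $\{M_0,M_1,M_2\}$ of $d\times d$ real matrices: (i) $M_0=M_1+M_2$; (ii) $H:=M_0+M_2$ is symmetric positive definite; (iii) $\|H^{-1/2}M_2H^{-1/2}\|_2<\frac12$, where $\|\cdot\|_2$ is the largest singular value. *)

(* Defs.v *)
From mathcomp Require Export all_boot all_order all_algebra.
From mathcomp Require Export all_classical all_reals all_analysis.

Set Implicit Arguments.
Unset Strict Implicit.
Unset Printing Implicit Defensive.

Import Order.TTheory GRing.Theory Num.Theory.
Import numFieldNormedType.Exports.

Local Open Scope classical_set_scope.
Local Open Scope ring_scope.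

Section Euclidean.
Context {R : realType} {d : nat}.

Definition dotv (x y : 'cV[R]_d) : R := (x^T *m y) 0 0.

(* The library's norm `|x| on matrices is the sup norm. *)
Definition norm2 (x : 'cV[R]_d) : R := Num.sqrt (dotv x x).

End Euclidean.

Section ConvexAnalysis.
Context {R : realType} {d : nat}.
Implicit Types (f : 'cV[R]_d -> \bar R) (C : set 'cV[R]_d).

Definition proper f : Prop :=
  (forall x, f x != -oo%E) /\ (exists x, f x != +oo%E).

(* For functions that never take the value -oo, so that no sum is
   indeterminate. *)
Definition econvex f : Prop :=
  forall (x y : 'cV[R]_d) (t : R), 0 < t < 1 ->
    (f (t *: x + (1 - t) *: y)%R <= t%:E * f x + (1 - t)%:E * f y)%E.

Definition Gamma0 f : Prop :=
  [/\ proper f, lower_semicontinuous f & econvex f].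

Definition edom f : set 'cV[R]_d := [set x | (f x < +oo)%E].

(* Value 0 on C and +oo elsewhere; not the characteristic function \1_C. *)
Definition iota_set C (x : 'cV[R]_d) : \bar R := if x \in C then 0%E else +oo%E.

Definition conjugate f (y : 'cV[R]_d) : \bar R :=
  ereal_sup (range (fun x => ((dotv x y)%:E - f x)%E)).

Definition argmin f : set 'cV[R]_d := [set u | forall w, (f u <= f w)%E].

(* For f in Gamma0 the argmin is a singleton; the default 0 is then not used. *)
Definition prox f (x : 'cV[R]_d) : 'cV[R]_d :=
  xget 0 (argmin (fun u => ((norm2 (u - x) ^+ 2 / 2)%:E + f u)%E)).

Definition affine_set C : Prop :=
  forall (x y : 'cV[R]_d) (t : R), C x -> C y -> C ((1 - t) *: x + t *: y).

Definition affine_hull C : set 'cV[R]_d := smallest affine_set C.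

Definition relint C : set 'cV[R]_d :=
  [set x | affine_hull C x /\ within (affine_hull C) (nbhs x) C].

End ConvexAnalysis.

Section MatrixNotions.
Context {R : realType} {d : nat}.
Implicit Types M S : 'M[R]_d.

Definition sympd M : Prop :=
  M^T = M /\ forall x : 'cV[R]_d, x != 0 -> 0 < dotv x (M *m x).

(* Meaningful for symmetric positive definite M, where such an S exists and is
   unique. *)
Definition sqrtmx M : 'M[R]_d := xget 0 [set S | sympd S /\ S *m S = M].

Definition singular_value M (sigma : R) : Prop :=
  0 <= sigma /\ eigenvalue (M^T *m M) (sigma ^+ 2).

(* A finite set, nonempty when 0 < d, so that the sup is a maximum. *)
Definition spectral_norm M : R := sup [set sigma | singular_value M sigma].

Definition condition_M (M0 M1 M2 : 'M[R]_d) : Prop :=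
  let H := M0 + M2 in
  let Hm12 := invmx (sqrtmx H) in
  [/\ M0 = M1 + M2, sympd H & spectral_norm (Hm12 *m M2 *m Hm12) < 2^-1].

End MatrixNotions.

(* R^n = R^(n_1) x ... x R^(n_s) is 'cV_(\sum_i n i), with blocks
   submxcol x i, and R^(n+m) is 'cV_(\sum_i n i + m), with parts usubmx v and
   dsubmx v. *)
Section Problem.
Context {R : realType} {s m : nat} {n : 'I_s -> nat}.
Local Notation N := (\sum_i n i)%N.
Implicit Types (f : forall i : 'I_s, 'cV[R]_(n i) -> \bar R)
  (A : forall i : 'I_s, 'M[R]_(m, n i)) (b : 'cV[R]_m)
  (alpha : 'I_s -> R) (beta : R).

Definition sep_sum f (x : 'cV[R]_N) : \bar R := (\sum_i f i (submxcol x i))%E.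

Definition Amx A : 'M[R]_(m, N) := \mxrow_i A i.

Definition feasible A b (x : 'cV[R]_N) : Prop :=
  \sum_i A i *m submxcol x i = b.

Definition solution f A b (x : 'cV[R]_N) : Prop :=
  feasible A b x /\
  forall z, feasible A b z -> (sep_sum f x <= sep_sum f z)%E.

Definition Tmap f b alpha beta (v : 'cV[R]_(N + m)) : 'cV[R]_(N + m) :=
  col_mx
    (\mxcol_i prox (fun u => ((alpha i / beta)%:E * f i u)%E)
                   (submxcol (usubmx v) i))
    (prox (fun y => (beta%:E * conjugate (iota_set [set b]) y)%E) (dsubmx v)).

Definition Pmx alpha beta : 'M[R]_N := \mxdiag_i (beta / alpha i)%:M.

Definition Rmx alpha beta : 'M[R]_(N + m) :=
  block_mx (Pmx alpha beta) 0 0 (beta^-1)%:M.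

Definition Emx A alpha beta : 'M[R]_(N + m) :=
  block_mx 1%:M (- (invmx (Pmx alpha beta) *m (Amx A)^T))
           (beta *: Amx A) 1%:M.

(* The graph of T_M: w is a value of T_M at (u1, u2). *)
Definition TM_graph f A b alpha beta (M0 M1 M2 : 'M[R]_(N + m))
    (u1 u2 w : 'cV[R]_(N + m)) : Prop :=
  let Rinv := invmx (Rmx alpha beta) in
  w = Tmap f b alpha beta
        ((Emx A alpha beta - Rinv *m M0) *m w
         + Rinv *m M1 *m u1 + Rinv *m M2 *m u2).

Definition TM_well_defined f A b alpha beta (M0 M1 M2 : 'M[R]_(N + m)) : Prop :=
  forall u1 u2, exists! w, TM_graph f A b alpha beta M0 M1 M2 u1 u2 w.

End Problem.

(* min_(1 <= i <= k) a i, for k >= 1. *)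
Definition min_upto {R : realType} (a : nat -> R) (k : nat) : R :=
  \big[Num.min/a 1%N]_(1 <= i < k.+1) a i.

(* Main.v *)
Require Import Defs.
From mathcomp Require Import finmap ring lra.
Set Implicit Arguments.
Unset Strict Implicit.
Unset Printing Implicit Defensive.
Import Order.TTheory GRing.Theory Num.Theory.
Import numFieldNormedType.Exports.
Local Open Scope classical_set_scope.
Local Open Scope ring_scope.

(** Write [K] for the skew matrix with blocks [0], [-A^T], [A], [0]. Since
    [R E = R + K] and [T] is the resolvent of the subdifferential of
    [Phi (x, y) = sum_i f_i x_i + <b, y>] in the metric [R], the recursion says
    that [K v_{k+1} - M0 (v_{k+1} - v_k) - M2 (v_k - v_{k-1})] is a subgradient
    of [Phi] at [v_{k+1}]. At a saddle point [v*] of the Lagrangian, [K v*] is a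
    subgradient of [Phi]. The subdifferential is monotone and [K] contributes
    nothing to the quadratic form, so

      [<v_{k+1} - v*, M0 (v_{k+1} - v_k) + M2 (v_k - v_{k-1})> <= 0].

    This is [Tmap_monotone].

    Put [e_k = v_k - v*], [d_k = v_{k+1} - v_k] and let [|.|_H] be the norm of
    the symmetric positive definite [H = M0 + M2]. Replacing [M0] by [H - M2]
    in the inequality makes the terms in [M2] telescope up to
    [<d_k, M2 d_{k-1}>], which Condition-M bounds by [q |d_k|_H |d_{k-1}|_H]
    for some [q < 1/2]. Hence the energy

      [|e_k|_H^2 / 2 - <e_k, M2 d_{k-1}> + (q / 2) |d_{k-1}|_H^2]

    is nonnegative and drops by at least [(1/2 - q) |d_k|_H^2] at each step
    ([energy_ge0], [energy_decrease]). So the [|d_k|^2] are summable. This is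
    the first rate, and the second holds for every summable nonnegative
    sequence, because the minimum up to [k] is at most the average of the
    terms from about [k / 2] to [k], a tail of the series divided by [k / 2].

    Three existence facts support this argument.
    - A saddle point exists: the relative interior condition makes the cone
      generated by the feasible perturbations a linear subspace, and the
      multiplier is built one coordinate at a time ([supporting_functional],
      [exists_multiplier]).
    - The proximal minimizations have solutions: a lower semicontinuous convex
      function has a minorant decreasing at most linearly in the distance, so
      the regularized function attains its minimum on a compact ball
      ([argmin_prox_exists]).
    - The square root of [H] exists, and the spectral norm bounds the action of
      a matrix on vectors: both come from maximizing a Rayleigh quotient on the
      sphere ([exists_top_eigenvector], [sympd_sqrt], [spectral_norm_lt]). *)

(** * Euclidean geometry and the spectral norm *)

Lemma dotvE (R : realType) d (x y : 'cV[R]_d) : dotv x y = \sum_i x i 0 * y i 0.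
Proof. by rewrite /dotv mxE; apply: eq_bigr => i _; rewrite mxE. Qed.

Lemma dotvC (R : realType) d (x y : 'cV[R]_d) : dotv x y = dotv y x.
Proof. by rewrite !dotvE; apply: eq_bigr => i _; rewrite mulrC. Qed.

Lemma dotvDl (R : realType) d (x y z : 'cV[R]_d) :
  dotv (x + y) z = dotv x z + dotv y z.
Proof. by rewrite /dotv linearD mulmxDl mxE. Qed.

Lemma dotvDr (R : realType) d (x y z : 'cV[R]_d) :
  dotv z (x + y) = dotv z x + dotv z y.
Proof. by rewrite /dotv mulmxDr mxE. Qed.

Lemma dotvZl (R : realType) d (a : R) (x y : 'cV[R]_d) :
  dotv (a *: x) y = a * dotv x y.
Proof. by rewrite /dotv linearZ /= -scalemxAl mxE. Qed.

Lemma dotvZr (R : realType) d (a : R) (x y : 'cV[R]_d) :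
  dotv x (a *: y) = a * dotv x y.
Proof. by rewrite /dotv -scalemxAr mxE. Qed.

Lemma dotvNl (R : realType) d (x y : 'cV[R]_d) : dotv (- x) y = - dotv x y.
Proof. by rewrite -scaleN1r dotvZl mulN1r. Qed.

Lemma dotvNr (R : realType) d (x y : 'cV[R]_d) : dotv x (- y) = - dotv x y.
Proof. by rewrite -scaleN1r dotvZr mulN1r. Qed.

Lemma dotv0l (R : realType) d (x : 'cV[R]_d) : dotv 0 x = 0.
Proof. by rewrite -(scale0r 0) dotvZl mul0r. Qed.

Lemma dotv0r (R : realType) d (x : 'cV[R]_d) : dotv x 0 = 0.
Proof. by rewrite dotvC dotv0l. Qed.

Lemma dotv_mull (R : realType) d e (M : 'M[R]_(e, d)) (x : 'cV[R]_d) y :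
  dotv (M *m x) y = dotv x (M^T *m y).
Proof. by rewrite /dotv trmx_mul mulmxA. Qed.

Definition dotv_bilin := (dotvDl, dotvDr, dotvNl, dotvNr, dotvZl, dotvZr).

Lemma dotv_ge0 (R : realType) d (x : 'cV[R]_d) : 0 <= dotv x x.
Proof. by rewrite dotvE; apply: sumr_ge0 => i _; rewrite -expr2 sqr_ge0. Qed.

Lemma dotv_eq0 (R : realType) d (x : 'cV[R]_d) : dotv x x = 0 -> x = 0.
Proof.
rewrite dotvE => /eqP; rewrite psumr_eq0 => [/allP xx0|i _]; last first.
  by rewrite -expr2 sqr_ge0.
apply/colP => i; have := xx0 i (mem_index_enum i); rewrite /= mulf_eq0 orbb.
by rewrite mxE => /eqP.
Qed.

Lemma dotv_gt0 (R : realType) d (x : 'cV[R]_d) : x != 0 -> 0 < dotv x x.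
Proof.
move=> x0; rewrite lt_neqAle dotv_ge0 andbT eq_sym.
by apply: contra x0 => /eqP/dotv_eq0/eqP.
Qed.

Lemma norm2_sqr (R : realType) d (x : 'cV[R]_d) : norm2 x ^+ 2 = dotv x x.
Proof. by rewrite sqr_sqrtr ?dotv_ge0. Qed.

Lemma norm2_ge0 (R : realType) d (x : 'cV[R]_d) : 0 <= norm2 x.
Proof. exact: sqrtr_ge0. Qed.

Lemma norm2Z (R : realType) d (a : R) (x : 'cV[R]_d) :
  norm2 (a *: x) = `|a| * norm2 x.
Proof.
by rewrite /norm2 dotvZl dotvZr mulrA -expr2 sqrtrM ?sqr_ge0// sqrtr_sqr.
Qed.

(** Cauchy-Schwarz, obtained by expanding the squared norm of
    [|y|^2 x - <x, y> y]. *)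
Lemma dotv_le (R : realType) d (x y : 'cV[R]_d) :
  `|dotv x y| <= norm2 x * norm2 y.
Proof.
have [y0|y0] := eqVneq y 0.
  by rewrite y0 dotv0r normr0 mulr_ge0 ?norm2_ge0.
rewrite -(@ler_pXn2r _ 2)// ?nnegrE ?mulr_ge0 ?norm2_ge0// exprMn !norm2_sqr.
rewrite -normrX ger0_norm ?sqr_ge0//.
have := dotv_ge0 (dotv y y *: x - dotv x y *: y).
rewrite !dotv_bilin (dotvC y x).
have := dotv_gt0 y0; set p := dotv y y; set q := dotv x x; set r := dotv x y.
move=> p0 h; rewrite -(ler_pM2l p0); nra.
Qed.

(** The topology on column vectors is that of the sup norm [`|x|]; this
    inequality transfers Euclidean estimates to it. *)
Lemma mx_norm_le_norm2 (R : realType) d (x : 'cV[R]_d) : `|x| <= norm2 x.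
Proof.
rewrite [leLHS]/Num.norm /= mx_normrE; apply/bigmax_leP; split.
  exact: norm2_ge0.
move=> -[i j] _ /=; rewrite (ord1 j) -(@ler_pXn2r _ 2)// ?nnegrE ?norm2_ge0//.
rewrite norm2_sqr dotvE -normrX ger0_norm ?sqr_ge0// (bigD1 i)//= -expr2 lerDl.
by apply: sumr_ge0 => k _; rewrite -expr2 sqr_ge0.
Qed.

Lemma continuous_trmx (R : realType) m n : continuous (@trmx R m n).
Proof.
move=> x /= A /nbhs_ballP[e e0 eA]; apply/nbhs_ballP; exists e => //= y [_ xy].
by apply: eA; split => // i j; rewrite !mxE; exact: xy.
Qed.

Lemma closed_bounded_compact (R : realType) d (A : set 'cV[R]_d) c (r : R) :
  closed A -> (forall x, A x -> norm2 (x - c) <= r) -> compact A.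
Proof.
move=> cA Ar.
have -> : A = (@trmx R 1 d) @` ((@trmx R 1 d) @^-1` A).
  by rewrite image_preimage// -subTset => x _; exists x^T => //; rewrite trmxK.
apply: continuous_compact; first exact/continuous_subspaceT/continuous_trmx.
apply: bounded_closed_compact.
  exists (r + `|c|); split; first exact: num_real.
  move=> t rt x /= /Ar xr; apply: le_trans (ltW rt).
  have : `|x^T| <= r + `|c|.
    rewrite -[x^T](subrK c) (le_trans (ler_normD _ _))// lerD2r.
    exact: le_trans (mx_norm_le_norm2 _) xr.
  apply: le_trans.
  rewrite [leLHS]/Num.norm/= mx_normrE; apply/bigmax_leP; split => // -[i j] _.
  rewrite [leRHS]/Num.norm/= mx_normrE; apply/bigmax_geP; right => /=.
  by exists (j, i) => //=; rewrite mxE.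
exact: (continuous_closedP _).1 (@continuous_trmx R 1 d) _ cA.
Qed.

Lemma continuous_qform (R : realType) d (M : 'M[R]_d) :
  continuous (fun x : 'cV[R]_d => dotv x (M *m x)).
Proof.
have -> : (fun x => dotv x (M *m x)) =
    (fun x => \sum_i \sum_j x i 0 * (M i j * x j 0)).
  apply/funext => x; rewrite dotvE; apply: eq_bigr => i _.
  by rewrite mxE mulr_sumr.
apply: continuous_big => [|i _]; first exact: add_continuous.
apply: continuous_big => [|j _]; first exact: add_continuous.
move=> x.
apply: (@continuousM _ _ (fun x : 'cV[R]_d => x i 0)
  (fun x : 'cV[R]_d => M i j * x j 0)); first exact: coord_continuous.
apply: (@continuousM _ _ (fun=> M i j) (fun x : 'cV[R]_d => x j 0)).
  exact: cst_continuous.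
exact: coord_continuous.
Qed.

Lemma continuous_dotv (R : realType) d (z : 'cV[R]_d) : continuous (dotv z).
Proof.
have -> : dotv z = (fun x => \sum_i z i 0 * x i 0).
  by apply/funext => x; rewrite dotvE.
apply: continuous_big => [|i _]; first exact: add_continuous.
move=> x; apply: (@continuousM _ _ (fun=> z i 0) (fun x : 'cV[R]_d => x i 0)).
  exact: cst_continuous.
exact: coord_continuous.
Qed.

Lemma continuous_norm2_sqr (R : realType) d (z : 'cV[R]_d) :
  continuous (fun x : 'cV[R]_d => norm2 (x - z) ^+ 2).
Proof.
have -> : (fun x : 'cV[R]_d => norm2 (x - z) ^+ 2) =
    (fun x : 'cV[R]_d => dotv x (1%:M *m x) + (- 2 * dotv z x + norm2 z ^+ 2)).
  apply/funext => x; rewrite !norm2_sqr mul1mx !dotv_bilin (dotvC x z); ring.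
move=> x; apply: (@continuousD _ _ _ (fun x : 'cV[R]_d => dotv x (1%:M *m x))
  (fun x => - 2 * dotv z x + norm2 z ^+ 2)); first exact: continuous_qform.
apply: (@continuousD _ _ _ (fun x : 'cV[R]_d => - 2 * dotv z x)); last first.
  exact: cst_continuous.
apply: (@continuousM _ _ (fun=> - 2) (dotv z)); first exact: cst_continuous.
exact: continuous_dotv.
Qed.

(** Along the line [t |-> x + t N x] the form takes the values
    [t (2 |N x|^2 + t <N x, N N x>)]; a nonzero [N x] would make them negative
    for small negative [t]. *)
Lemma psd_form_kernel (R : realType) d (N : 'M[R]_d) (x : 'cV[R]_d) :
  N^T = N -> (forall y, 0 <= dotv y (N *m y)) -> dotv x (N *m x) = 0 ->
  N *m x = 0.
Proof.
move=> sN psN Nx0; apply: dotv_eq0; set z := N *m x.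
set a := dotv z z; set c := dotv z (N *m z).
have a0 : 0 <= a by exact: dotv_ge0.
have c0 : 0 <= c by exact: psN.
have h t : 0 <= t * (2 * a + t * c).
  have := psN (x + t *: z).
  rewrite mulmxDr -scalemxAr !dotv_bilin Nx0 -/z -/c.
  have -> : dotv x (N *m z) = a by rewrite -[N in N *m z]sN -dotv_mull.
  by rewrite -/a; congr (_ <= _); ring.
apply/eqP; rewrite eq_le a0 andbT leNgt; apply/negP => apos.
have c1 : 0 < c + 1 by lra.
have := h (- a / (c + 1)).
have -> : - a / (c + 1) * (2 * a + - a / (c + 1) * c) =
  - (a ^+ 2 * (c + 2) / (c + 1) ^+ 2) by field; rewrite gt_eqF.
rewrite oppr_ge0 leNgt => /negP; apply.
by rewrite divr_gt0 ?mulr_gt0 ?exprn_gt0// ltr_wpDl.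
Qed.

(** A maximizer [u] of the quadratic form over the compact unit sphere works:
    with [lam] its value there, [lam I - M] is positive semidefinite and its
    form vanishes at [u], so [psd_form_kernel] applies. *)
Lemma exists_top_eigenvector (R : realType) d (M : 'M[R]_d.+1) : M^T = M ->
  exists (lam : R) (u : 'cV[R]_d.+1),
    [/\ dotv u u = 1, M *m u = lam *: u &
        forall y, dotv y (M *m y) <= lam * dotv y y].
Proof.
move=> sM.
pose S := [set x : 'cV[R]_d.+1 | dotv x x = 1].
have S0 : S !=set0.
  exists (delta_mx 0 0); rewrite /S/= dotvE (bigD1 0)//= !mxE eqxx mul1r.
  by rewrite big1 ?addr0// => i i0; rewrite !mxE (negbTE i0) mul0r.
have cS : compact S.
  apply: (@closed_bounded_compact _ _ _ 0 1) => [|x Sx]; last first.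
    by rewrite subr0 /norm2 Sx sqrtr1.
  have -> : S = (fun x : 'cV[R]_d.+1 => dotv x (1%:M *m x)) @^-1` [set 1].
    by apply/seteqP; split => x /=; rewrite mul1mx.
  exact: (continuous_closedP _).1 (@continuous_qform _ _ _) _ (@closed_eq _ _).
have [u uS umax] := compact_EVT_max S0 cS
  (continuous_subspaceT (@continuous_qform _ _ M)).
move: uS; rewrite in_setE => uS.
exists (dotv u (M *m u)), u.
have le y : dotv y (M *m y) <= dotv u (M *m u) * dotv y y.
  have [->|y0] := eqVneq y 0; first by rewrite dotv0l dotv0r mulr0.
  have n0 : 0 < norm2 y by rewrite sqrtr_gt0 dotv_gt0.
  have : (norm2 y)^-1 *: y \in S.
    by rewrite in_setE /S/= dotvZl dotvZr -norm2_sqr; field; rewrite gt_eqF.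
  move=> /umax; rewrite -scalemxAr dotvZl dotvZr -norm2_sqr mulrA -expr2.
  by rewrite exprVn -ler_pdivlMl ?invr_gt0 ?exprn_gt0// invrK mulrC.
split => //; apply/eqP; rewrite eq_sym -subr_eq0 -mul_scalar_mx -mulmxBl.
apply/eqP; apply: psd_form_kernel.
- by rewrite linearB /= tr_scalar_mx sM.
- by move=> y; rewrite mulmxBl mul_scalar_mx dotvDr dotvZr dotvNr subr_ge0.
- by rewrite mulmxBl mul_scalar_mx dotvDr dotvZr dotvNr uS mulr1 subrr.
Qed.

(** The square root of the largest eigenvalue of [M^T M] works, since
    [|M x|^2 = <x, M^T M x>]. *)
Lemma norm2_mulmx_singular (R : realType) d (M : 'M[R]_d.+1) :
  exists2 sigma : R, singular_value M sigma &
    forall x, norm2 (M *m x) <= sigma * norm2 x.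
Proof.
have sMM : (M^T *m M)^T = M^T *m M by rewrite trmx_mul trmxK.
have [lam [u [uu Mu lemax]]] := exists_top_eigenvector sMM.
have MM y : dotv y (M^T *m M *m y) = norm2 (M *m y) ^+ 2.
  by rewrite norm2_sqr dotv_mull mulmxA.
have lam0 : 0 <= lam.
  have := MM u; rewrite Mu dotvZr uu mulr1 => ->; exact: sqr_ge0.
exists (Num.sqrt lam).
  split; first exact: sqrtr_ge0.
  rewrite sqr_sqrtr//; apply/eigenvalueP; exists u^T.
    by rewrite -{1}sMM -trmx_mul Mu linearZ.
  apply/eqP => /(congr1 trmx); rewrite trmxK trmx0 => u0.
  by move: uu; rewrite u0 dotv0l => /esym/eqP; rewrite oner_eq0.
move=> x; rewrite -(@ler_pXn2r _ 2)// ?nnegrE ?mulr_ge0 ?norm2_ge0 ?sqrtr_ge0//.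
by rewrite exprMn -MM norm2_sqr sqr_sqrtr.
Qed.

(** The strict inequality transfers from the supremum of the singular values
    to an operator bound [q]. The set of singular values must be shown to be
    bounded, because the supremum of an unbounded set is a default value. *)
Lemma spectral_norm_lt (R : realType) d (M : 'M[R]_d.+1) (c : R) :
  spectral_norm M < c ->
  exists q, [/\ 0 <= q, q < c & forall x, norm2 (M *m x) <= q * norm2 x].
Proof.
move=> Mc; have [q [q0 qeig] Mq] := norm2_mulmx_singular M.
exists q; split => //; apply: le_lt_trans Mc.
apply: ub_le_sup; last by split.
exists q => sigma [sigma0 /eigenvalueP[y /(congr1 trmx)]].
rewrite !trmx_mul trmxK linearZ /= => ysig y0.
have yn0 : 0 < norm2 y^T.
  rewrite sqrtr_gt0 dotv_gt0//; apply: contra y0 => /eqP/(congr1 trmx).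
  by rewrite trmxK trmx0 => /eqP.
have : norm2 (M *m y^T) ^+ 2 = (sigma * norm2 y^T) ^+ 2.
  by rewrite norm2_sqr dotv_mull mulmxA ysig dotvZr exprMn norm2_sqr.
move=> /eqP; rewrite eqrXn2 ?mulr_ge0 ?norm2_ge0// => /eqP Ms.
by rewrite -(ler_pM2r yn0) -Ms Mq.
Qed.

(** * Square roots of positive definite matrices *)

Lemma outer_mul (R : realType) d (w x : 'cV[R]_d) :
  w *m w^T *m x = dotv w x *: w.
Proof.
by rewrite -mulmxA [w^T *m x]mx11_scalar mul_mx_scalar.
Qed.

(** The Householder reflection in the hyperplane orthogonal to [a - b]. *)
Lemma householder (R : realType) d (a b : 'cV[R]_d) :
  dotv a a = 1 -> dotv b b = 1 ->
  exists Q : 'M[R]_d, [/\ Q^T = Q, Q *m Q = 1%:M & Q *m a = b].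
Proof.
move=> aa bb; have [<-|ab] := eqVneq a b.
  by exists 1%:M; rewrite trmx1 !mul1mx.
set w := a - b.
have w0 : dotv w w != 0 by rewrite gt_eqF// dotv_gt0// subr_eq0.
have ww : dotv w w = 2 * dotv w a.
  by rewrite /w !dotv_bilin aa bb (dotvC b a); ring.
exists (1%:M - (2 / dotv w w) *: (w *m w^T)); split.
- by rewrite linearB linearZ /= trmx1 trmx_mul trmxK.
- have : w *m w^T *m (w *m w^T) = dotv w w *: (w *m w^T).
    by rewrite mulmxA outer_mul scalemxAl.
  move: (w *m w^T) => W WW.
  rewrite mulmxBl mul1mx mulmxBr mulmx1 -scalemxAl -scalemxAr WW.
  by apply/matrixP => i j; rewrite !mxE; field.
- rewrite mulmxBl mul1mx -scalemxAl outer_mul scalerA ww.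
  have -> : 2 / (2 * dotv w a) * dotv w a = 1.
    by field; move: w0; rewrite ww mulf_eq0 negb_or => /andP[].
  by rewrite scale1r /w opprB addrC subrK.
Qed.

(** Deflation: after a reflection sending a unit eigenvector to the first basis
    vector, the matrix splits into the eigenvalue and a smaller symmetric
    positive definite block, to which the induction applies. *)
Lemma sympd_sqrt (R : realType) d (M : 'M[R]_d) : sympd M ->
  exists S, sympd S /\ S *m S = M.
Proof.
elim: d M => [|d IH] M [sM pM].
  by exists M; split => //; apply/matrixP => -[].
have [lam [u [uu Mu _]]] := exists_top_eigenvector sM.
have u0 : u != 0.
  by apply: contra_eq_neq uu => ->; rewrite dotv0l eq_sym oner_eq0.
have lam0 : 0 < lam by have := pM _ u0; rewrite Mu dotvZr uu mulr1.
pose e : 'cV[R]_(1 + d) := col_mx 1%:M 0.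
have ee : dotv e e = 1.
  rewrite /dotv /e tr_col_mx mul_row_col trmx0 mul0mx addr0.
  by rewrite trmx1 mul1mx !mxE.
have [Q [sQ QQ Qe]] := householder ee uu.
have Qu : Q *m u = e by rewrite -Qe mulmxA QQ mul1mx.
pose N : 'M[R]_(1 + d) := Q *m M *m Q.
have sN : N^T = N by rewrite /N !trmx_mul sQ sM mulmxA.
have Ne : N *m e = lam *: e.
  by rewrite /N -!mulmxA Qe Mu -scalemxAr Qu.
have pN x : x != 0 -> 0 < dotv x (N *m x).
  move=> x0; rewrite /N -!mulmxA -{1}sQ -dotv_mull pM//.
  by apply: contra x0 => /eqP Qx; rewrite -[x]mul1mx -QQ -mulmxA Qx mulmx0.
have dlN : dlsubmx N = 0 /\ ulsubmx N = lam%:M.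
  move: Ne; rewrite -{1}[N]submxK /e mul_block_col !mulmx1 !mulmx0 !addr0.
  by rewrite scale_col_mx scaler0 scalemx1 => /eq_col_mx[].
have NE : N = block_mx lam%:M 0 0 (drsubmx N).
  rewrite -{1}[N]submxK dlN.1 dlN.2; congr block_mx.
  by rewrite -[N in LHS]sN -trmx_dlsub dlN.1 trmx0.
have [S' [[sS' pS'] SS']] : exists S, sympd S /\ S *m S = drsubmx N.
  apply: IH; split; first by rewrite trmx_drsub sN.
  move=> y y0.
  have /pN : col_mx (0 : 'cV[R]_1) y != 0.
    by rewrite col_mx_eq0 negb_and y0 orbT.
  rewrite {1}NE mul_block_col !mul0mx !mulmx0 !add0r /dotv tr_col_mx.
  by rewrite mul_row_col trmx0 mul0mx add0r.
pose B : 'M[R]_(1 + d) := block_mx (Num.sqrt lam)%:M 0 0 S'.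
have sB : B^T = B by rewrite /B tr_block_mx !trmx0 tr_scalar_mx sS'.
exists (Q *m B *m Q); split; [split|].
- by rewrite !trmx_mul sQ sB mulmxA.
- move=> x x0; rewrite -!mulmxA -{1}sQ -dotv_mull.
  have : Q *m x != 0.
    by apply: contra x0 => /eqP Qx; rewrite -[x]mul1mx -QQ -mulmxA Qx mulmx0.
  move: (Q *m x) => z; rewrite -[z]vsubmxK.
  move: (usubmx z) (dsubmx z) => z1 z2.
  rewrite mul_block_col !mul0mx addr0 add0r mul_scalar_mx.
  have -> : dotv (col_mx z1 z2) (col_mx (Num.sqrt lam *: z1) (S' *m z2)) =
      Num.sqrt lam * dotv z1 z1 + dotv z2 (S' *m z2).
    by rewrite /dotv tr_col_mx mul_row_col mxE -scalemxAr mxE.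
  have sl : 0 < Num.sqrt lam by rewrite sqrtr_gt0.
  rewrite col_mx_eq0 negb_and; have [->|z20 _] := eqVneq z2 0.
    by rewrite orbF dotv0l addr0 => z10; rewrite mulr_gt0// dotv_gt0.
  by rewrite ltr_wpDl ?pS'// mulr_ge0 ?dotv_ge0// ltW.
- have -> : Q *m B *m Q *m (Q *m B *m Q) = Q *m (B *m (Q *m Q) *m B) *m Q.
    by rewrite !mulmxA.
  rewrite QQ mulmx1 mulmx_block !mul0mx !mulmx0 !addr0 !add0r -scalar_mxM.
  rewrite -expr2 sqr_sqrtr ?ltW// SS' -NE /N.
  by rewrite !mulmxA QQ mul1mx -mulmxA QQ mulmx1.
Qed.

Lemma injective_unitmx (R : realType) d (M : 'M[R]_d) :
  (forall x : 'cV_d, M *m x = 0 -> x = 0) -> M \in unitmx.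
Proof.
move=> injM; rewrite -unitmx_tr -row_free_unit; apply/inj_row_free => y yM.
apply: trmx_inj; rewrite trmx0; apply: injM.
by rewrite -[M]trmxK -trmx_mul yM trmx0.
Qed.

(** The form in which Condition-M is used. With [S] the symmetric square root,
    [<x, M2 y> = <S x, (S^-1 M2 S^-1) (S y)>]; the constant [c] is the operator
    norm of [S^-1]. *)
Lemma sqrtmx_factor (R : realType) d (H M2 : 'M[R]_d) :
  (0 < d)%N -> sympd H ->
  spectral_norm (invmx (sqrtmx H) *m M2 *m invmx (sqrtmx H)) < 2^-1 ->
  exists (S : 'M[R]_d) (q c : R),
    [/\ S^T *m S = H, 0 <= q < 2^-1,
     forall x y, `|dotv x (M2 *m y)| <= q * norm2 (S *m x) * norm2 (S *m y) &
     forall x, norm2 x <= c * norm2 (S *m x)].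
Proof.
case: d H M2 => // d H M2 _ pH; have [S0 S0P] := sympd_sqrt pH.
have := xgetPex 0 (ex_intro _ S0 S0P : [set S | sympd S /\ S *m S = H] !=set0).
rewrite -/(sqrtmx H); set S := sqrtmx H => -[[sS pS] SS].
have uS : S \in unitmx.
  apply: injective_unitmx => x Sx; apply/eqP; apply: contraT => /pS.
  by rewrite Sx dotv0r ltxx.
have [c _ cS] := norm2_mulmx_singular (invmx S).
move=> /spectral_norm_lt[q [q0 q2 hq]]; exists S, q, c; split.
- by rewrite sS.
- by rewrite q0 q2.
- move=> x y.
  have -> : dotv x (M2 *m y) =
      dotv (S *m x) (invmx S *m M2 *m invmx S *m (S *m y)).
    by rewrite dotv_mull sS -!mulmxA mulKmx// mulKVmx.
  apply: le_trans (dotv_le _ _) _.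
  by rewrite (mulrC q) -mulrA ler_wpM2l ?norm2_ge0.
- by move=> x; have := cS (S *m x); rewrite mulKmx.
Qed.

(** * Lagrange multipliers *)

(** [G] plays the role of the epigraph of a convex function that is nonnegative
    at 0 and whose domain generates a linear subspace as a cone. The
    functional is built coordinate by coordinate, as in the one-dimensional
    step of the Hahn-Banach theorem; the last hypothesis ensures that the
    domain meets one side of a hyperplane as soon as it meets the other, so that
    the slope along each new coordinate is a finite supremum. *)
Lemma supporting_functional (R : realType) m (G : 'cV[R]_m -> R -> Prop) :
  (forall u v r s t, G u r -> G v s -> 0 < t < 1 ->
     G (t *: u + (1 - t) *: v) (t * r + (1 - t) * s)) ->
  (forall r, G 0 r -> 0 <= r) ->
  (forall u r, G u r -> exists e s, 0 < e /\ G (- e *: u) s) ->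
  exists y, forall u r, G u r -> 0 <= dotv y u + r.
Proof.
move=> Gconv G0 Gsym.
suff H k : (k <= m)%N -> exists y, forall u r, G u r ->
    (forall i : 'I_m, (k <= i)%N -> u i 0 = 0) -> 0 <= dotv y u + r.
  have [y Gy] := H m (leqnn m); exists y => u r /Gy; apply => i.
  by rewrite leqNgt ltn_ord.
elim: k => [_|k IH km].
  exists 0 => u r Gur u0; rewrite dotv0l add0r; apply: G0.
  suff <- : u = 0 by [].
  by apply/colP => i; rewrite mxE u0.
have [y Gy] := IH (ltnW km); pose i0 := Ordinal km.
pose supp (u : 'cV[R]_m) := forall i : 'I_m, (k < i)%N -> u i 0 = 0.
pose Z := [set z | exists u r, [/\ G u r, supp u, 0 < u i0 0 &
                                   z = - (dotv y u + r) / u i0 0]].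
(* The slope of the functional along the new coordinate must separate the
   values [Z] seen on the positive side from those on the negative side. *)
have sep z u r : Z z -> G u r -> supp u -> u i0 0 < 0 ->
    z <= (dotv y u + r) / - u i0 0.
  move=> [u1 [r1 [G1 s1 p1 ->]]] G2 s2 n2.
  set a := u1 i0 0 in p1 *; set b := u i0 0 in n2 *.
  have ab : 0 < a - b by lra.
  (* The weight for which the combination has a zero coordinate [i0]. *)
  pose t := - b / (a - b).
  have t01 : 0 < t < 1.
    by rewrite divr_gt0 ?oppr_gt0//= ltr_pdivrMr// mul1r; lra.
  have /Gy := Gconv _ _ _ _ _ G1 G2 t01.
  have /[swap]/[apply] : forall i : 'I_m, (k <= i)%N ->
      (t *: u1 + (1 - t) *: u) i 0 = 0.
    move=> i; rewrite !mxE leq_eqVlt => /orP[/eqP ki|ki]; last first.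
      by rewrite s1// s2// !mulr0 addr0.
    have -> : i = i0 by exact/val_inj.
    by rewrite -/a -/b /t; field; rewrite gt_eqF.
  rewrite !dotv_bilin => h.
  rewrite ler_pdivrMr// mulrAC ler_pdivlMr ?oppr_gt0//.
  have : 0 <= (a - b) * (t * dotv y u1 + (1 - t) * dotv y u
     + (t * r1 + (1 - t) * r)) by rewrite mulr_ge0// ltW.
  have -> : (a - b) * (t * dotv y u1 + (1 - t) * dotv y u
     + (t * r1 + (1 - t) * r)) = - b * (dotv y u1 + r1) + a * (dotv y u + r).
    by rewrite /t; field; rewrite gt_eqF.
  by lra.
have Zneg u r : G u r -> supp u -> u i0 0 < 0 -> Z !=set0.
  move=> Gu su n; have [e [s [e0 Gs]]] := Gsym _ _ Gu.
  exists (- (dotv y (- e *: u) + s) / (- e *: u) i0 0), (- e *: u), s.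
  split => //; last by rewrite mxE mulNr oppr_gt0 pmulr_rlt0.
  by move=> i ki; rewrite mxE su// mulr0.
have Zub : Z !=set0 -> has_ubound Z.
  move=> [z [u [r [Gu su p _]]]]; have [e [s [e0 Gs]]] := Gsym _ _ Gu.
  exists ((dotv y (- e *: u) + s) / - (- e *: u) i0 0) => z' Zz'.
  apply: sep => //; last by rewrite mxE mulNr oppr_lt0 mulr_gt0.
  by move=> i ki; rewrite mxE su// mulr0.
exists (y + sup Z *: delta_mx i0 0) => u r Gu su.
have -> : dotv (y + sup Z *: delta_mx i0 0) u = dotv y u + sup Z * u i0 0.
  rewrite dotvDl dotvZl; congr (_ + _ * _).
  rewrite dotvE (bigD1 i0)//= !mxE !eqxx mul1r big1 ?addr0// => i /negbTE ii0.
  by rewrite !mxE ii0 mul0r.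
have [n|p|z] := ltgtP (u i0 0) 0.
- have Z0 := Zneg _ _ Gu su n.
  have : sup Z <= (dotv y u + r) / - u i0 0.
    by apply: ge_sup => // z Zz; exact: sep.
  by rewrite ler_pdivlMr ?oppr_gt0//; lra.
- have Zz : Z (- (dotv y u + r) / u i0 0) by exists u, r.
  have : - (dotv y u + r) / u i0 0 <= sup Z.
    by apply: ub_le_sup => //; apply: Zub; exists (- (dotv y u + r) / u i0 0).
  by rewrite ler_pdivrMr//; lra.
- rewrite z mulr0 addr0; apply: Gy => // i.
  rewrite leq_eqVlt => /orP[/eqP ki|]; last exact: su.
  by have -> : i = i0 by exact/val_inj.
Qed.

(** The prolonged segment stays in the affine hull, in which [C] is a
    neighborhood of [x0]. *)
Lemma relint_prolong (R : realType) d (C : set 'cV[R]_d) x0 x :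
  relint C x0 -> C x -> exists2 e, 0 < e & C (x0 - e *: (x - x0)).
Proof.
move=> [hx0 /nbhs_ballP[e /= e0 eC]] Cx.
have hx : affine_hull C x by move=> B [_]; exact.
pose t := e / (2 * (norm2 (x - x0) + 1)).
have n0 : 0 < norm2 (x - x0) + 1 by rewrite ltr_wpDl ?norm2_ge0.
have t0 : 0 < t by rewrite divr_gt0// mulr_gt0.
exists t => //; apply: eC.
  rewrite -ball_normE /ball_/= opprB addrC subrK.
  apply: le_lt_trans (mx_norm_le_norm2 _) _; rewrite norm2Z gtr0_norm//.
  rewrite /t mulrAC ltr_pdivrMr ?mulr_gt0// ltr_pM2l//.
  by have := norm2_ge0 (x - x0); lra.
move=> B [aB CB]; have := aB x0 x (- t) (hx0 B (conj aB CB)) (CB _ Cx).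
by congr B; rewrite opprK scalerDl scale1r scaleNr scalerBr opprB -addrA.
Qed.

(** Strong duality for [min F x s.t. A x = b] under the relative interior
    qualification: the values of the perturbed problem form a convex set of
    the kind handled by [supporting_functional]. *)
Lemma exists_multiplier (R : realType) N m (F : 'cV[R]_N -> \bar R)
    (A : 'M[R]_(m, N)) (b : 'cV[R]_m) (xs : 'cV[R]_N) :
  (forall x, F x != -oo%E) -> econvex F ->
  ((fun x => A *m x) @` relint (edom F)) b ->
  A *m xs = b -> (forall x, A *m x = b -> (F xs <= F x)%E) ->
  exists (p : R) (y : 'cV[R]_m), F xs = p%:E /\
    forall x, (p%:E <= F x + (dotv y (A *m x - b))%:E)%E.
Proof.
move=> Fnoo Fconv [x0 rx0 Ax0] Axs xsmin.
have Fx0 : (F x0 < +oo)%E.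
  by case: rx0 => hx0 /nbhs_singleton; exact.
have Fxs : F xs \is a fin_num.
  by rewrite fin_numE Fnoo /= -ltey (le_lt_trans (xsmin _ Ax0)).
set p := fine (F xs).
have pE : F xs = p%:E by rewrite fineK.
pose G (u : 'cV[R]_m) (r : R) :=
  exists2 x, u = A *m x - b & (F x <= (p + r)%:E)%E.
have [| | |y Gy] := @supporting_functional _ _ G.
- move=> u v r s t [x -> Fx] [z -> Fz] t01; exists (t *: x + (1 - t) *: z).
    rewrite mulmxDr -!scalemxAr !scalerBr addrACA -opprD -scalerDl.
    by rewrite (addrC t) subrK scale1r.
  apply: le_trans (Fconv _ _ _ t01) _.
  have -> : p + (t * r + (1 - t) * s) = t * (p + r) + (1 - t) * (p + s) by ring.
  case/andP: t01 => t0 t1.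
  rewrite [leRHS]EFinD !EFinM leeD// lee_pmul2l//= ?lte_fin ?subr_gt0//.
- move=> r [x /esym/eqP]; rewrite subr_eq0 => /eqP /xsmin; rewrite pE => h1 h2.
  by have := le_trans h1 h2; rewrite lee_fin lerDl.
- move=> u r [x -> Fx].
  have [e e0 Ce] : exists2 e, 0 < e & edom F (x0 - e *: (x - x0)).
    by apply: relint_prolong => //; exact: le_lt_trans Fx (ltey _).
  exists e, (fine (F (x0 - e *: (x - x0))) - p); split => //.
  exists (x0 - e *: (x - x0)).
    by rewrite mulmxBr -scalemxAr mulmxBr Ax0 scaleNr addrAC subrr add0r.
  by rewrite (addrC p) subrK fineK// fin_numE Fnoo /= -ltey.
exists p, y; split => // x.
have [Fx|] := boolP (F x \is a fin_num).
  have : 0 <= dotv y (A *m x - b) + (fine (F x) - p).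
    by apply: Gy; exists x => //; rewrite addrC subrK fineK.
  by rewrite -(fineK Fx) -EFinD lee_fin; lra.
by rewrite fin_numE Fnoo /= negbK => /eqP ->; rewrite addye// leey.
Qed.

(** * Proximal maps *)

(** If no point of [K] were a minimizer, the open sets [r < f] with [r] above
    some value of [f] on [K] would cover [K]; the smallest [r] of a finite
    subcover gives a contradiction. *)
Lemma lsc_compact_min (X : ptopologicalType) (R : realType) (f : X -> \bar R)
    (K : set X) : lower_semicontinuous f -> compact K -> K !=set0 ->
  exists2 w, K w & forall u, K u -> (f w <= f u)%E.
Proof.
move=> /lower_semicontinuousP flsc cK [k0 Kk0]; apply: contrapT => nomin.
have below x : K x -> exists2 y, K y & (f y < f x)%E.
  move=> Kx; apply: contrapT => nx; apply: nomin; exists x => // u Ku.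
  by rewrite leNgt; apply/negP => fux; apply: nx; exists u.
have mid (a c : \bar R) : (a < c)%E ->
    exists2 r : R, (a < r%:E)%E & (r%:E < c)%E.
  case: a c => [a| |] [c| |]//.
  - rewrite lte_fin => ac; exists ((a + c) / 2); rewrite lte_fin; lra.
  - by move=> _; exists (a + 1); rewrite ?ltey// lte_fin ltrDl.
  - by move=> _; exists (c - 1); rewrite ?ltNye// lte_fin gtrDl oppr_lt0.
  - by move=> _; exists 0; rewrite ?ltey ?ltNye.
move: cK; rewrite compact_cover.
move=> /(_ R [set r | exists2 y, K y & (f y < r%:E)%E]
            (fun r => [set x | (r%:E < f x)%E])) [].
- by move=> r _; exact: flsc.
- move=> x Kx; have [y Ky /mid[r yr rx]] := below _ Kx.
  by exists r => //=; exists y.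
move=> D sD KD.
have [r1 /= r1D _] := KD _ Kk0.
pose i0 : D := [` r1D]%fset.
have [i _ imin] := arg_minP val (isT : (fun=> true) i0).
have [y Ky yr] := set_mem (sD _ (fsvalP i)).
have [r rD /= ry] := KD _ Ky.
have := lt_trans ry yr; rewrite lte_fin ltNge.
by rewrite (imin [` rD]%fset).
Qed.

Lemma lsc_add_continuous (X : topologicalType) (R : realType) (g : X -> R)
    (f : X -> \bar R) : continuous g -> lower_semicontinuous f ->
  lower_semicontinuous (fun x => (g x)%:E + f x)%E.
Proof.
move=> cg lf x a ax.
have [r [e [e0 ar rf]]] : exists r e,
    [/\ 0 < e, a - g x + e <= r & (r%:E < f x)%E].
  move: ax; case: (f x) => [c| |].
  - rewrite -EFinD lte_fin => acx.
    exists ((a - g x + c) / 2), ((c + g x - a) / 2); rewrite lte_fin.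
    by split; lra.
  - by move=> _; exists (a - g x + 1), 1; rewrite ltey.
  - by rewrite addeNy.
have [V nV VP] := lf _ _ rf.
have nW : nbhs x [set y | g x - e < g y].
  have := cg x [set y | g x - e < y]; apply; apply: open_nbhs_nbhs.
  by split; [exact: open_gt|rewrite /= gtrDl oppr_lt0].
exists (V `&` [set y | g x - e < g y]); first exact: filterI.
move=> y [/VP ry /= gy].
apply: (@lt_le_trans _ _ ((g y)%:E + r%:E)%E); last by rewrite leeD2l// ltW.
by rewrite -EFinD lte_fin; lra.
Qed.

(** Lower semicontinuity bounds [f] from below near a point [u0] of its
    domain, and convexity propagates the bound along the rays from [u0]. *)
Lemma convex_lsc_minorant (R : realType) d (f : 'cV[R]_d -> \bar R) u0 (p : R) :
  lower_semicontinuous f -> econvex f -> f u0 = p%:E ->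
  exists2 c : R, 0 < c & forall u, ((p - 1 - c * norm2 (u - u0))%:E <= f u)%E.
Proof.
move=> lf cf fu0.
have [] := lf u0 (p - 1); first by rewrite fu0 lte_fin gtrDl oppr_lt0.
move=> V /nbhs_ballP[e /= e0 eV] VP.
have near u : norm2 (u - u0) < e -> ((p - 1)%:E < f u)%E.
  move=> ue; apply/VP/eV; rewrite -ball_normE /ball_/= distrC.
  exact: le_lt_trans (mx_norm_le_norm2 _) ue.
exists (2 / e); first by rewrite divr_gt0.
move=> u; have [ue|eu] := ltP (norm2 (u - u0)) e.
  apply: le_trans (ltW (near _ ue)); rewrite lee_fin gerDl oppr_le0.
  by rewrite mulr_ge0 ?norm2_ge0// ltW// divr_gt0.
have n0 : 0 < norm2 (u - u0) by exact: lt_le_trans eu.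
(* The point at distance [e / 2] from [u0] on the segment to [u]. *)
set t := e / 2 / norm2 (u - u0).
have t0 : 0 < t by rewrite !divr_gt0.
have t1 : t < 1 by rewrite ltr_pdivrMr// mul1r; lra.
have t01 : 0 < t < 1 by rewrite t0.
have /near : norm2 (t *: u + (1 - t) *: u0 - u0) < e.
  have -> : t *: u + (1 - t) *: u0 - u0 = t *: (u - u0).
    by rewrite scalerBl scale1r scalerBr addrCA addrAC subrr add0r.
  by rewrite norm2Z gtr0_norm// /t mulfVK ?gt_eqF//; lra.
move=> /lt_le_trans/(_ (cf _ _ _ t01)); rewrite fu0.
case: (f u) => [r| |]; last 2 first.
- by rewrite leey.
- by rewrite gt0_muleNy ?lte_fin// addNye ltNge leNye.
rewrite -!EFinM -EFinD lte_fin lee_fin => h.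
have tn : t * (2 / e * norm2 (u - u0)) = 1.
  by rewrite /t; field; rewrite !gt_eqF.
rewrite -(ler_pM2l t0); nra.
Qed.

(** The quadratic term beats the linear decrease allowed by
    [convex_lsc_minorant], so it suffices to minimize over a ball. *)
Lemma argmin_prox_exists (R : realType) d (f : 'cV[R]_d -> \bar R) z :
  Gamma0 f ->
  argmin (fun u => ((norm2 (u - z) ^+ 2 / 2)%:E + f u)%E) !=set0.
Proof.
move=> [[fNy [u0 fu0]] lf cf].
have {}fu0 : f u0 \is a fin_num by rewrite fin_numE fNy.
set p := fine (f u0).
have pE : f u0 = p%:E by rewrite fineK.
have [c c0 fc] := convex_lsc_minorant lf cf pE.
set h := fun u => _.
have lh : lower_semicontinuous h.
  apply: lsc_add_continuous => // x.
  apply: (@continuousM _ _ (fun u : 'cV[R]_d => norm2 (u - z) ^+ 2)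
    (fun=> 2^-1)).
    exact: continuous_norm2_sqr.
  exact: cst_continuous.
set q := norm2 (z - u0).
(* Outside the ball of radius [r] around [u0] the objective exceeds its value
   at [u0]. *)
pose r := 2 * (q + c) + 2.
have q0 : 0 <= q by exact: norm2_ge0.
have r0 : 0 <= r by rewrite /r; lra.
pose K := [set u : 'cV[R]_d | norm2 (u - u0) ^+ 2 <= r ^+ 2].
have K0 : K u0 by rewrite /K/= norm2_sqr subrr dotv0l sqr_ge0.
have cK : compact K.
  apply: (@closed_bounded_compact _ _ _ u0 r).
    exact: (continuous_closedP _).1 (@continuous_norm2_sqr _ _ u0) _
      (@closed_le _ _).
  by move=> u; rewrite /K/=; rewrite ler_pXn2r ?nnegrE ?norm2_ge0.
have [w Kw wmin] := lsc_compact_min lh cK (ex_intro _ _ K0).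
exists w => u; have [/wmin//|] := boolP (norm2 (u - u0) ^+ 2 <= r ^+ 2).
rewrite -ltNge ltr_pXn2r ?nnegrE ?norm2_ge0// => ru.
apply: le_trans (wmin _ K0) _; rewrite /h pE.
apply: (@le_trans _ _ ((norm2 (u - z) ^+ 2 / 2)%:E
   + (p - 1 - c * norm2 (u - u0))%:E)%E); last by rewrite leeD2l.
rewrite -!EFinD lee_fin.
have -> : norm2 (u0 - z) ^+ 2 = q ^+ 2.
  by rewrite -[u0 - z]opprB /q !norm2_sqr dotvNl dotvNr opprK.
have -> : u - z = (u - u0) - (z - u0) by rewrite opprB addrA subrK.
have -> : norm2 (u - u0 - (z - u0)) ^+ 2 =
    norm2 (u - u0) ^+ 2 - 2 * dotv (u - u0) (z - u0) + q ^+ 2.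
  by rewrite !norm2_sqr; move: (u - u0) (z - u0) => a a';
    rewrite !dotv_bilin (dotvC a' a); ring.
have := dotv_le (u - u0) (z - u0); rewrite -/q ler_norml => /andP[_].
move: ru; rewrite /r.
set n := norm2 (u - u0); set s := dotv _ _ => ru sn.
nra.
Qed.

(** Compare the minimizer [w] with the points [w + t (u - w)], bound [f] there
    by convexity, and let [t] tend to 0. *)
Lemma prox_subgradient (R : realType) d (f : 'cV[R]_d -> \bar R) z :
  Gamma0 f -> exists p : R, f (prox f z) = p%:E /\
    forall u, ((p + dotv (z - prox f z) (u - prox f z))%:E <= f u)%E.
Proof.
move=> Gf; have := Gf => -[[fNy [u0 fu0]] lf cf].
have [w0 w0P] := argmin_prox_exists z Gf.
have := xgetPex 0 (ex_intro _ w0 w0P).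
rewrite -/(prox f z); move: (prox f z) => w wmin.
have fw : f w \is a fin_num.
  rewrite fin_numE fNy /=; apply/eqP => fwy.
  have := wmin u0; rewrite fwy addey// leye_eq.
  by move: fu0 (fNy u0); case: (f u0).
exists (fine (f w)); rewrite fineK//; split => // u.
set p := fine (f w).
have pE : f w = p%:E by rewrite fineK.
have [fu|] := boolP (f u \is a fin_num); last first.
  by rewrite fin_numE fNy /= negbK => /eqP ->; rewrite leey.
set s := fine (f u).
have sE : f u = s%:E by rewrite fineK.
rewrite sE lee_fin.
set g := dotv (z - w) (u - w); set D := dotv (u - w) (u - w).
have D0 : 0 <= D by exact: dotv_ge0.
have step t : 0 < t < 1 -> g <= s - p + t / 2 * D.
  move=> t01; have := cf u w t t01; rewrite sE pE -!EFinM -EFinD => ft.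
  have /le_trans := wmin (t *: u + (1 - t) *: w).
  move=> /(_ _ (leeD2l _ ft)); rewrite pE -!EFinD lee_fin.
  have -> : t *: u + (1 - t) *: w - z = t *: (u - w) - (z - w).
    by apply/matrixP => i j; rewrite !mxE; ring.
  rewrite -[w - z]opprB !norm2_sqr.
  have -> : dotv (t *: (u - w) - (z - w)) (t *: (u - w) - (z - w)) =
      t ^+ 2 * D - 2 * t * g + dotv (z - w) (z - w).
    rewrite /D /g; move: (u - w) (z - w) => a a'.
    by rewrite !dotv_bilin (dotvC a a'); ring.
  rewrite dotvNl dotvNr opprK => h.
  case/andP: t01 => t0 t1; rewrite -(ler_pM2l t0); lra.
rewrite leNgt; apply/negP => sp.
(* If the claim failed, [step] would fail for a small enough [t]; the added 1
   keeps [t] below 1 when [u = w]. *)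
pose g' := g - (s - p).
have g0 : 0 < g' by rewrite /g'; lra.
have d0 : 0 < g' + D + 1 by lra.
have := step (g' / (g' + D + 1)).
rewrite divr_gt0//= ltr_pdivrMr// mul1r => /(_ _)/wrap[]; first by lra.
rewrite -lerBlDl -/g' => h.
have : g' * (g' + D + 1) <= g' * D / 2.
  have -> : g' * D / 2 = g' / (g' + D + 1) / 2 * D * (g' + D + 1).
    by field; rewrite gt_eqF.
  by rewrite ler_pM2r.
nra.
Qed.

Lemma Gamma0_scale (R : realType) d (f : 'cV[R]_d -> \bar R) (c : R) : 0 < c ->
  Gamma0 f -> Gamma0 (fun u => (c%:E * f u)%E).
Proof.
move=> c0 [[fNy [u0 fu0]] lf cf]; split; first split.
- move=> x; have := fNy x; case: (f x) => [r| |]//.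
  by rewrite gt0_muley ?lte_fin.
- exists u0; move: fu0 (fNy u0); case: (f u0) => [r| |]//.
- move=> x a; rewrite -lte_pdivrMl// -EFinM => /lf[V nV VP]; exists V => // y.
  by move=> /VP; rewrite EFinM lte_pdivrMl.
- move=> x y t t01.
  have cfx := cf x y t t01.
  rewrite (le_trans (lee_wpmul2l _ cfx)) ?lee_fin ?(ltW c0)//.
  rewrite muleDr//.
    by rewrite [X in (X + _)%E]muleCA [X in (_ + X)%E]muleCA.
  move: (fNy x) (fNy y); case/andP: t01 => t0 t1.
  have t1' : 0 < 1 - t by rewrite subr_gt0.
  by case: (f x) => [r| |]//; case: (f y) => [s| |]// _ _;
    rewrite /adde_def ?gt0_muley ?lte_fin.
Qed.

Lemma prox_scaled_subgradient (R : realType) d (f : 'cV[R]_d -> \bar R)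
    (c : R) z :
  0 < c -> Gamma0 f ->
  let w := prox (fun u => (c%:E * f u)%E) z in
  exists r : R, f w = r%:E /\
    forall u, ((r + c^-1 * dotv (z - w) (u - w))%:E <= f u)%E.
Proof.
move=> c0 Gf w; have [p [wE wP]] := prox_subgradient z (Gamma0_scale c0 Gf).
have fwE : f w = (c^-1 * p)%:E.
  move: wE; rewrite -/w; case: (f w) => [r [<-]| |].
  - by rewrite mulKf ?gt_eqF.
  - by rewrite gt0_muley ?lte_fin.
  - by rewrite gt0_muleNy ?lte_fin.
exists (c^-1 * p); split => // u.
have := wP u; rewrite -mulrDr -/w.
by rewrite EFinM lee_pdivrMl.
Qed.

Lemma conjugate_indicator_point (R : realType) m (b y : 'cV[R]_m) :
  conjugate (iota_set [set b]) y = (dotv b y)%:E.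
Proof.
apply/le_anti/andP; split.
  apply: ge_ereal_sup => _ [x _ <-]; rewrite /iota_set.
  case: ifPn => [|_]; last by rewrite /= leNye.
  by move/set_mem => /= ->; rewrite sube0.
apply: ereal_sup_ubound; exists b => //.
by rewrite /iota_set mem_set// sube0.
Qed.

(** Up to a constant, the objective is half the squared distance to
    [z - beta b]. *)
Lemma prox_indicator_conjugate (R : realType) m (b z : 'cV[R]_m) (beta : R) :
  prox (fun y => (beta%:E * conjugate (iota_set [set b]) y)%E) z =
  z - beta *: b.
Proof.
rewrite /prox; set h := (fun u => _ : \bar R); set c := z - beta *: b.
pose K := beta * dotv b z - beta ^+ 2 * dotv b b / 2.
have hE u : h u = (norm2 (u - c) ^+ 2 / 2 + K)%:E.
  rewrite /h conjugate_indicator_point -EFinM -EFinD; congr EFin.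
  rewrite !norm2_sqr /c /K !dotv_bilin (dotvC z b) (dotvC u b) (dotvC u z).
  by field.
have cmin : argmin h c.
  move=> u; rewrite !hE lee_fin lerD2r subrr norm2_sqr dotv0l mul0r.
  by rewrite divr_ge0 ?sqr_ge0.
have /(_ c) := xgetPex 0 (ex_intro _ c cmin).
rewrite !hE lee_fin lerD2r subrr (norm2_sqr 0) dotv0l mul0r.
set w := xget _ _ => wc; apply/eqP; rewrite -subr_eq0.
apply/eqP/dotv_eq0/eqP; rewrite eq_le dotv_ge0 andbT -norm2_sqr.
by move: wc; rewrite pmulr_lle0.
Qed.

(** * Rates for summable sequences *)

Section SummableRates.
Context {R : realType} (a : nat -> R) (B : R).
Context (a_ge0 : forall i, 0 <= a i).
Context (a_sum : forall k, \sum_(1 <= i < k.+1) a i <= B).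

Lemma average_bigO :
  (fun k : nat => k%:R^-1 * \sum_(1 <= i < k.+1) a i) =O_\oo
  (fun k : nat => k%:R^-1 : R).
Proof.
have B0 : 0 <= B by apply: le_trans (a_sum 0); rewrite big_geq.
apply/eqO_exP; exists (B + 1); first by rewrite ltr_wpDl.
near=> k; rewrite normrM mulrC ler_wpM2r// ger0_norm ?sumr_ge0//.
by apply: le_trans (a_sum k) _; rewrite lerDl.
Unshelve. all: by end_near. Qed.

Lemma min_upto_le (k i : nat) : (1 <= i <= k)%N -> min_upto a k <= a i.
Proof.
move=> /andP[i1 ik]; apply: (@bigmin_inf_seq _ _ _ _ _ i) => //.
by rewrite mem_index_iota i1 ltnS.
Qed.

Lemma min_upto_ge0 k : 0 <= min_upto a k.
Proof. by apply: le_bigmin. Qed.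

(** Half of the terms up to [k] lie in a tail of the convergent series, and
    each of them dominates the minimum. *)
Lemma min_upto_littleo : min_upto a =o_\oo (fun k : nat => k%:R^-1 : R).
Proof.
pose s k := \sum_(1 <= i < k.+1) a i.
have s_sup : has_sup (range s).
  by split; [exists (s 0); exists 0%N|exists B => _ [k _ <-]; exact: a_sum].
apply/eqoP => e e0.
have [_ [n0 _ <-] sn0] := sup_adherent (divr_gt0 e0 (ltr0Sn R 1)) s_sup.
near=> k.
have k0 : (0 < k)%N by near: k; exact: nbhs_infty_gt.
have nk : (2 * n0 <= k)%N by near: k; exact: nbhs_infty_ge.
have nk1 : (n0 <= k)%N by apply: leq_trans nk; rewrite leq_pmull.
rewrite ger0_norm ?min_upto_ge0// ger0_norm ?invr_ge0//.
rewrite ler_pdivlMr ?ltr0n//.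
have : s k - s n0 <= e / 2.
  have : s k <= sup (range s) by apply: ub_le_sup; [exact: s_sup.2|exists k].
  move: sn0; lra.
rewrite /s (@big_cat_nat _ _ _ n0.+1)//= ?ltnS// addrAC subrr add0r => tail.
have : min_upto a k * (k - n0)%:R <= e / 2.
  apply: le_trans tail; rewrite mulr_natr -[X in _ *+ X](subSS n0).
  rewrite -sumr_const_nat; apply: ler_sum_nat => i /andP[ni ik].
  by apply: min_upto_le; rewrite (leq_ltn_trans _ ni) //= -ltnS.
rewrite natrB//; have := min_upto_ge0 k; move: (min_upto a k) => mu mu0 h.
have : (2 * n0)%:R <= k%:R :> R by rewrite ler_nat.
rewrite natrM; nra.
Unshelve. all: by end_near. Qed.

End SummableRates.

(** * The energy *)

Section Energy.
Context {R : realType} {d : nat} (S M0 M2 : 'M[R]_d) (q : R).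
Context (HE : S^T *m S = M0 + M2).
Context (q01 : 0 <= q < 2^-1).
Context (M2q : forall x y,
  `|dotv x (M2 *m y)| <= q * norm2 (S *m x) * norm2 (S *m y)).

(** With [e] the distance vector to the saddle point and [d'] the last step; [S]
    is a square root of [H], so that [|x|_H] is [norm2 (S *m x)]. *)
Definition energy (e d' : 'cV[R]_d) : R :=
  norm2 (S *m e) ^+ 2 / 2 - dotv e (M2 *m d') + q / 2 * norm2 (S *m d') ^+ 2.

(** Young's inequality leaves [(1 - q) |e|_H^2 / 2] as a lower bound. *)
Lemma energy_ge0 e d' : 0 <= energy e d'.
Proof.
rewrite /energy; have := M2q e d'; rewrite ler_norml => /andP[_].
have /andP[q0 q2] := q01.
move: (norm2 (S *m e)) (norm2 (S *m d')) (dotv _ _) => x y z zq.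
have : 0 <= q * (x - y) ^+ 2 by rewrite mulr_ge0 ?sqr_ge0.
have : 0 <= (2^-1 - q) * x ^+ 2 by rewrite mulr_ge0 ?sqr_ge0 ?subr_ge0 1?ltW.
nra.
Qed.

(** The term [<d1, M2 d'>], the only one that does not telescope, is bounded by
    [(q / 2) (|d1|_H^2 + |d'|_H^2)]. The last term of the old energy pays for
    the second half; the gain [|d1|_H^2 / 2] of the quadratic term pays for the
    first half and for the last term of the new energy. *)
Lemma energy_decrease e d' d1 :
  dotv (e + d1) (M0 *m d1 + M2 *m d') <= 0 ->
  energy (e + d1) d1 + (2^-1 - q) * norm2 (S *m d1) ^+ 2 <= energy e d'.
Proof.
have -> : dotv (e + d1) (M0 *m d1 + M2 *m d') = dotv (S *m (e + d1)) (S *m d1)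
    - dotv (e + d1) (M2 *m d1) + dotv (e + d1) (M2 *m d').
  have -> : M0 = S^T *m S - M2 by rewrite HE addrK.
  by rewrite dotv_mull mulmxBl mulmxA !dotv_bilin; ring.
rewrite /energy !mulmxDr norm2_sqr !dotvDl !dotvDr -!norm2_sqr.
rewrite (dotvC (S *m d1) (S *m e)).
have := M2q d1 d'; rewrite ler_norml => /andP[+ _].
have /andP[q0 _] := q01.
have : 0 <= q * (norm2 (S *m d1) - norm2 (S *m d')) ^+ 2.
  by rewrite mulr_ge0 ?sqr_ge0.
lra.
Qed.

Lemma sum_energy (v : nat -> 'cV[R]_d) vs :
  (forall k, (1 <= k)%N -> dotv (v k.+1 - vs)
     (M0 *m (v k.+1 - v k) + M2 *m (v k - v k.-1)) <= 0) ->
  forall k, (2^-1 - q) * \sum_(1 <= i < k.+1) norm2 (S *m (v i.+1 - v i)) ^+ 2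
    <= energy (v 1%N - vs) (v 1%N - v 0%N).
Proof.
move=> key k; set L1 := energy _ _.
suff : energy (v k.+1 - vs) (v k.+1 - v k) + (2^-1 - q) *
    \sum_(1 <= i < k.+1) norm2 (S *m (v i.+1 - v i)) ^+ 2 <= L1.
  by apply: le_trans; rewrite lerDr energy_ge0.
elim: k => [|k IH]; first by rewrite big_geq// mulr0 addr0.
rewrite big_nat_recr//= mulrDr addrA addrAC; apply: le_trans IH.
rewrite lerD2r.
have -> : v k.+2 - vs = (v k.+1 - vs) + (v k.+2 - v k.+1).
  by rewrite [RHS]addrC addrA subrK.
apply: energy_decrease.
have -> : (v k.+1 - vs) + (v k.+2 - v k.+1) = v k.+2 - vs.
  by rewrite [LHS]addrC addrA subrK.
exact: key.
Qed.

End Energy.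

(** * Monotonicity of the splitting operator *)

Section SaddlePoint.
Context {R : realType} {s m : nat} {n : 'I_s -> nat}.
Local Notation N := (\sum_i n i)%N.
Implicit Types (x y : 'cV[R]_N).

Lemma dotv_mxcol x y :
  dotv x y = \sum_i dotv (submxcol x i) (submxcol y i).
Proof.
rewrite -{1}(submxcolK x) -{1}(submxcolK y) /dotv tr_mxcol mul_mxrow_mxcol.
by rewrite summxE.
Qed.

Lemma dotv_col_mx p r (x x' : 'cV[R]_p) (y y' : 'cV[R]_r) :
  dotv (col_mx x y) (col_mx x' y') = dotv x x' + dotv y y'.
Proof. by rewrite /dotv tr_col_mx mul_row_col mxE. Qed.

Lemma Amx_mul (A : forall i : 'I_s, 'M[R]_(m, n i)) x :
  Amx A *m x = \sum_i A i *m submxcol x i.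
Proof. by rewrite -{1}(submxcolK x) /Amx mul_mxrow_mxcol. Qed.

Lemma Pmx_mul (alpha : 'I_s -> R) (beta : R) x :
  Pmx alpha beta *m x = \mxcol_i ((beta / alpha i) *: submxcol x i) :> 'cV[R]_N.
Proof.
rewrite -{1}(submxcolK x) /Pmx mul_mxdiag_mxcol.
by apply: eq_mxcol => i; rewrite mul_scalar_mx.
Qed.

Lemma Pmx_unit (alpha : 'I_s -> R) (beta : R)
    (halpha : forall i, 0 < alpha i) (hbeta : 0 < beta) :
  Pmx alpha beta \in @unitmx R N.
Proof.
apply: injective_unitmx => x; rewrite Pmx_mul => Px0; apply/mxcolP => i.
move/mxcolP/(_ i): Px0; rewrite mxcolK !submxcol0 => /eqP.
by rewrite scaler_eq0 gt_eqF ?divr_gt0//= => /eqP.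
Qed.

Lemma Rmx_unit (alpha : 'I_s -> R) (beta : R)
    (halpha : forall i, 0 < alpha i) (hbeta : 0 < beta) :
  Rmx alpha beta \in @unitmx R (N + m).
Proof.
rewrite unitmxE det_lblock unitrM -unitmxE Pmx_unit//=.
by rewrite det_scalar unitrX// unitfE invr_eq0 gt_eqF.
Qed.

(** The linear part of the optimality system of the Lagrangian, which is
    [R (E - I)]. *)
Definition Kmx (A : forall i : 'I_s, 'M[R]_(m, n i)) : 'M[R]_(N + m) :=
  block_mx 0 (- (Amx A)^T) (Amx A) 0.

Lemma Rmx_Emx (A : forall i : 'I_s, 'M[R]_(m, n i))
    (alpha : 'I_s -> R) (beta : R)
    (halpha : forall i, 0 < alpha i) (hbeta : 0 < beta) :
  Rmx alpha beta *m Emx A alpha beta = Rmx alpha beta + Kmx A.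
Proof.
rewrite /Rmx /Emx mulmx_block !mul0mx !mulmx1 !addr0 !add0r.
rewrite mulmxN mulKVmx ?Pmx_unit// mul_scalar_mx scalerA mulVf ?gt_eqF//.
by rewrite scale1r /Kmx add_block_mx addr0 !add0r addr0.
Qed.

Lemma sep_sumNy (f : forall i : 'I_s, 'cV[R]_(n i) -> \bar R)
    (hf : forall i, Gamma0 (f i)) x : sep_sum f x != -oo%E.
Proof.
apply/eqP => /esum_eqNyP[i [_ _ /eqP]].
by have [[/(_ (submxcol x i))/negP]] := hf i.
Qed.

Lemma sep_sum_convex (f : forall i : 'I_s, 'cV[R]_(n i) -> \bar R)
    (hf : forall i, Gamma0 (f i)) : econvex (sep_sum f).
Proof.
move=> x y t t01; rewrite /sep_sum.
have def z :
    {in xpredT &, forall i j, (f i (submxcol z i) +? f j (submxcol z j))%E}.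
  move=> i j _ _; have [[/(_ (submxcol z i)) + _] _ _] := hf i.
  have [[/(_ (submxcol z j)) + _] _ _] := hf j.
  by rewrite /adde_def => /negbTE-> /negbTE->; rewrite andbF.
rewrite !fin_num_sume_distrr// -big_split; apply: lee_sum => i _ /=.
have [_ _ /(_ (submxcol x i) (submxcol y i) t t01)] := hf i.
congr (f i _ <= _)%E; rewrite submxcolD; congr (_ + _);
  by apply/matrixP => j k; rewrite !mxE.
Qed.

(** Both halves of a saddle point [(xs, y)] are used: the subgradients produced
    by the proximal maps are tested at [xs], and the Lagrangian inequality of
    [y] is tested at the output [w]. *)
Lemma Tmap_monotone (f : forall i : 'I_s, 'cV[R]_(n i) -> \bar R)
    (hf : forall i, Gamma0 (f i))
    (A : forall i : 'I_s, 'M[R]_(m, n i)) (b : 'cV[R]_m)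
    (alpha : 'I_s -> R) (beta : R)
    (halpha : forall i, 0 < alpha i) (hbeta : 0 < beta)
    (xs : 'cV[R]_N) (y : 'cV[R]_m) (p : R) (w z : 'cV[R]_(N + m)) :
  sep_sum f xs = p%:E -> Amx A *m xs = b ->
  (forall x, (p%:E <= sep_sum f x + (dotv y (Amx A *m x - b))%:E)%E) ->
  w = Tmap f b alpha beta z ->
  0 <= dotv (w - col_mx xs y) (Rmx alpha beta *m (z - w) - Kmx A *m w).
Proof.
move=> Fxs Axs lagr wT.
set wx := usubmx w; set wy := dsubmx w; set zx := usubmx z; set zy := dsubmx z.
have wyE : zy - wy = beta *: b.
  rewrite /wy wT /Tmap col_mxKd prox_indicator_conjugate.
  by rewrite opprB addrC subrK.
have wxE i : submxcol wx i =
    prox (fun u => ((alpha i / beta)%:E * f i u)%E) (submxcol zx i).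
  by rewrite /wx wT /Tmap col_mxKu mxcolK.
have fw i : {r | f i (submxcol wx i) = r%:E &
    forall u, ((r + beta / alpha i *
      dotv (submxcol zx i - submxcol wx i) (u - submxcol wx i))%:E <= f i u)%E}.
  have c0 : 0 < alpha i / beta by rewrite divr_gt0.
  apply: cid2; have [r] := prox_scaled_subgradient (submxcol zx i) c0 (hf i).
  by rewrite -wxE invf_div => -[]; exists r.
have Fw : sep_sum f wx = (\sum_i s2val (fw i))%:E.
  by rewrite -sumEFin; apply: eq_bigr => i _; case: (fw i).
have h1 :
  \sum_i s2val (fw i) + dotv (Pmx alpha beta *m (zx - wx)) (xs - wx) <= p.
  rewrite -lee_fin -Fxs dotv_mxcol -big_split -sumEFin /=.
  apply: lee_sum => i _; case: (fw i) => r frE /= /(_ (submxcol xs i)).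
  congr (_ <= _)%E; congr (r + _)%:E.
  by rewrite Pmx_mul mxcolK dotvZl !submxcolB.
have h2 := lagr wx; rewrite Fw -EFinD lee_fin in h2.
move: h1 h2; move: (\sum_i _) => F h1 h2.
have -> : w - col_mx xs y = col_mx (wx - xs) (wy - y).
  by rewrite -[w]vsubmxK opp_col_mx add_col_mx.
have -> : Rmx alpha beta *m (z - w) - Kmx A *m w =
  col_mx (Pmx alpha beta *m (zx - wx) + (Amx A)^T *m wy) (b - Amx A *m wx).
  rewrite -[z]vsubmxK -[w]vsubmxK opp_col_mx add_col_mx -/wx -/wy -/zx -/zy.
  rewrite /Rmx /Kmx !mul_block_col !mul0mx !addr0 !add0r wyE.
  rewrite mul_scalar_mx scalerA mulVf ?gt_eqF// scale1r.
  by rewrite opp_col_mx add_col_mx mulNmx opprK.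
rewrite dotv_col_mx (dotvDr _ _ (wx - xs)) -dotv_mull (mulmxBr (Amx A)) Axs.
move: h1 h2; rewrite (dotvC (Pmx _ _ *m _)) -[xs - wx]opprB !dotv_bilin.
rewrite (dotvC (Amx A *m wx)) (dotvC b); lra.
Qed.

End SaddlePoint.

(** * Rates of the iteration *)

Theorem theorem5p2 (R : realType) (s m : nat) (n : 'I_s -> nat)
    (hs : (0 < s)%N) (hm : (0 < m)%N) (hn : forall i, (0 < n i)%N)
    (f : forall i : 'I_s, 'cV[R]_(n i) -> \bar R)
    (hf : forall i, Gamma0 (f i))
    (A : forall i : 'I_s, 'M[R]_(m, n i)) (b : 'cV[R]_m)
    (alpha : 'I_s -> R) (halpha : forall i, 0 < alpha i)
    (beta : R) (hbeta : 0 < beta)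
    (hsol : exists x, solution f A b x)
    (hri : ((fun x => Amx A *m x) @` relint (edom (sep_sum f))) b)
    (M0 M1 M2 : 'M[R]_(\sum_i n i + m))
    (hTM : TM_well_defined f A b alpha beta M0 M1 M2)
    (v0 v1 : 'cV[R]_(\sum_i n i + m))
    (v : nat -> 'cV[R]_(\sum_i n i + m))
    (hv0 : v 0%N = v0) (hv1 : v 1%N = v1)
    (hv : forall k, (1 <= k)%N ->
       v k.+1 = Tmap f b alpha beta
         ((Emx A alpha beta - invmx (Rmx alpha beta) *m M0) *m v k.+1
          + invmx (Rmx alpha beta) *m M1 *m v k
          + invmx (Rmx alpha beta) *m M2 *m v k.-1))
    (hM : condition_M M0 M1 M2) :
  (fun k : nat => k%:R^-1 * \sum_(1 <= i < k.+1) norm2 (v i.+1 - v i) ^+ 2)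
    =O_\oo (fun k : nat => k%:R^-1 : R)
  /\
  min_upto (fun i => norm2 (v i.+1 - v i) ^+ 2)
    =o_\oo (fun k : nat => k%:R^-1 : R).
Proof.
have [HM pH normM2] := hM.
have [S [q [c [SH q01 M2q cS]]]] := sqrtmx_factor (ltn_addl _ hm) pH normM2.
have [xs [xs_feas xs_min]] := hsol.
have Axs : Amx A *m xs = b by rewrite Amx_mul.
have Amin x : Amx A *m x = b -> (sep_sum f xs <= sep_sum f x)%E.
  by rewrite Amx_mul; exact: xs_min.
have [p [y [Fxs lagr]]] := exists_multiplier (sep_sumNy hf)
  (sep_sum_convex hf) hri Axs Amin.
pose vs : 'cV[R]_(\sum_i n i + m) := col_mx xs y.
have uR : Rmx alpha beta \in @unitmx R (\sum_i n i + m).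
  exact: Rmx_unit.
(* The resolvent inequality of [Tmap_monotone], with the recursion used to
   eliminate [R (z - v_{k+1})]. *)
have key k : (1 <= k)%N -> dotv (v k.+1 - vs)
    (M0 *m (v k.+1 - v k) + M2 *m (v k - v k.-1)) <= 0.
  move=> k1; have := Tmap_monotone hf halpha hbeta Fxs Axs lagr (hv k k1).
  set z := _ + _ + _.
  rewrite -/vs -oppr_le0 -dotvNr; congr (dotv _ _ <= 0).
  have Rz : Rmx alpha beta *m z = Rmx alpha beta *m v k.+1 + Kmx A *m v k.+1
      - M0 *m v k.+1 + M1 *m v k + M2 *m v k.-1.
    rewrite /z !mulmxDr -!mulmxA !(mulKVmx uR) mulmxBl mulmxBr !mulmxA.
    by rewrite Rmx_Emx// mulmxDl mulmxV// mul1mx.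
  rewrite mulmxBr Rz HM !mulmxDl !mulmxBr.
  move: (Rmx alpha beta *m _) (Kmx A *m _) (M1 *m _) => a1 a2 a3.
  move: (M2 *m v k.+1) => a4.
  move: (M1 *m v k) (M2 *m v k) (M2 *m v k.-1) => a5 a6 a7.
  by apply/matrixP => i j; rewrite !mxE; ring.
have Sk := sum_energy SH q01 M2q key.
set a := fun i => norm2 (v i.+1 - v i) ^+ 2.
have a0 i : 0 <= a i by exact: sqr_ge0.
have q2 : 0 < 2^-1 - q by case/andP: q01; rewrite subr_gt0.
have [B aB] : exists B, forall k, \sum_(1 <= i < k.+1) a i <= B.
  exists (c ^+ 2 * ((2^-1 - q)^-1 *
    energy S M2 q (v 1%N - vs) (v 1%N - v 0%N))).
  move=> k; have := Sk k; rewrite -ler_pdivlMl// => Sk'.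
  apply: le_trans (ler_wpM2l (sqr_ge0 c) Sk').
  rewrite mulr_sumr; apply: ler_sum => i _; rewrite -exprMn.
  by rewrite /a lerXn2r ?nnegrE ?norm2_ge0// (le_trans (norm2_ge0 _) (cS _)).
by split; [exact: average_bigO aB|exact: min_upto_littleo aB].
Qed.
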